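(* Let $\alpha\in(0,1)$, $\theta=\alpha/2$, $\varepsilon>0$, $h=L/M$, and consider a (generally nonuniform) time mesh $0=t_0<t_1<\dots<t_N=T$ with steps $\tau_k=t_k-t_{k-1}$, maximum step $\tau=\max_{1\le k\le N}\tau_k$, and step ratios $r_k=\tau_k/\tau_{k-1}$ satisfying $4/7\le r_k\le r^*$ for $2\le k\le N$, where the maximum ratio $r^*$ is bounded. Let the stabilization parameter satisfy $\kappa\ge\|f'\|_{C[-1,1]}$. If the time stepsize satisfies $$\tau\le\left(\frac{4}{11(1-\theta)\left(4\varepsilon^2/h^2+\kappa\right)\Gamma(2-\alpha)}\right)^{1/\alpha},$$ then the stabilized IMEX-Alikhanov scheme (see context) with $\phi^0=\phi_{\rm init}$ on the grid preserves the maximum bound principle for $\{\phi^n\}$, i.e., the discrete version of the maximum bound principle is valid: $$\|\phi_{\rm init}\|_\infty\le 1\quad\Longrightarrow\quad\|\phi^n\|_\infty\le1\quad\text{for all }1\le n\le N .$$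
   Context: The scheme discretizes the time-fractional Allen--Cahn equation $\partial_t^\alpha\phi=\varepsilon^2\Delta\phi+f(\phi)$ ($\partial_t^\alpha$ the Caputo derivative of order $\alpha$, $0<\varepsilon\ll1$ the interfacial width parameter) with initial value $\phi_{\rm init}$. Nonlinearity: $f=-F'$, where the nonlinear potential $F$ is assumed to be bistable; a typical example is the double-well potential $F(\phi)=\frac14(1-\phi^2)^2$, for which $f(\phi)=\phi-\phi^3$. Space grid: $\Omega=(0,L)^2$ with periodic boundary conditions, $M$ a positive integer, $h=L/M$, grid points $(ih,jh)$. $\mathbb V_h$ is the space of real grid functions $v=(v_{ij})$ that are $M$-periodic in $i$ and in $j$; $\|v\|_\infty=\max_{1\le i,j\le M}|v_{ij}|$; $\Delta_hv_{ij}=h^{-2}(v_{i+1,j}+v_{i-1,j}+v_{i,j+1}+v_{i,j-1}-4v_{ij})$. The function $f$ and min/max act pointwise on grid functions. Alikhanov formula: $\omega_\mu(t)=t^{\mu-1}/\Gamma(\mu)$, $t_{n-\theta}=(1-\theta)t_n+\theta t_{n-1}$, $t_{k-1/2}=(t_k+t_{k-1})/2$, $\nabla_\tau w^k=w^k-w^{k-1}$, and $$\mathbb D_\tau^\alpha w^n=\sum_{k=1}^nA^{(n)}_{n-k}\nabla_\tau w^k ,$$ where $$a^{(n)}_{n-k}=\frac1{\tau_k}\int_{t_{k-1}}^{\min\{t_k,t_{n-\theta}\}}\omega_{1-\alpha}(t_{n-\theta}-s)\,ds\quad(1\le k\le n),$$ $$b^{(n)}_{n-k}=\frac{2}{\tau_k(\tau_k+\tau_{k+1})}\int_{t_{k-1}}^{t_k}(s-t_{k-1/2})\,\omega_{1-\alpha}(t_{n-\theta}-s)\,ds\quad(1\le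 k\le n-1),$$ $A^{(1)}_0=a^{(1)}_0$, and for $n\ge2$: $A^{(n)}_0=a^{(n)}_0+b^{(n)}_1/r_n$; $A^{(n)}_{n-k}=a^{(n)}_{n-k}+b^{(n)}_{n-k+1}/r_k-b^{(n)}_{n-k}$ for $2\le k\le n-1$; $A^{(n)}_{n-1}=a^{(n)}_{n-1}-b^{(n)}_{n-1}$. Stabilized IMEX-Alikhanov scheme: $\phi^0=\phi_{\rm init}$ on the grid; $\bar\phi^{n,\theta}=(1-\theta)\phi^n+\theta\phi^{n-1}$; $\widehat\phi^{1,\theta}=\phi^0$, and for $n\ge2$ $$\widehat\phi^{n,\theta}=\min\{\max\{(1+(1-\theta)r_n)\phi^{n-1}-(1-\theta)r_n\phi^{n-2},-1\},1\};$$ for $1\le n\le N$, $\phi^n\in\mathbb V_h$ is the (unique) solution of $$\mathbb D_\tau^\alpha\phi^n=\varepsilon^2\Delta_h\bar\phi^{n,\theta}+f(\widehat\phi^{n,\theta})-\kappa(\bar\phi^{n,\theta}-\widehat\phi^{n,\theta}).$$ *)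

(* Defs.v *)
From HB Require Import structures.
From mathcomp Require Import all_boot all_order all_algebra.
From mathcomp Require Import all_classical all_reals all_analysis.

Set Implicit Arguments.
Unset Strict Implicit.
Unset Printing Implicit Defensive.

Import Order.TTheory GRing.Theory Num.Theory.
Import numFieldNormedType.Exports.
Local Open Scope classical_set_scope.
Local Open Scope ring_scope.

Section Potential.
Context {R : realType}.
Implicit Types F g : R -> R.

Definition strict_local_min F (x : R) : Prop := \forall y \near x^', F x < F y.

(* The phase variable is normalized so that the two stable states (wells)
   of the potential are -1 and 1; the wells may have different depths. *)
Definition bistable F : Prop :=
  forall x : R, x \in `[-1, 1] -> (strict_local_min F x <-> x = -1 \/ x = 1).

Definition C1_on_m11 g : Prop :=
  (forall x : R, x \in `[-1, 1] -> derivable g x 1) /\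
  {within `[-1, 1], continuous (derive1 g)}.

Definition C_norm_m11 g : R := sup [set `|g x| | x in `[-1, 1]].

End Potential.

(* A grid function on the periodic M x M grid is indexed by int * int,
   so that i + 1 and i - 1 need no wrap-around. *)
Section Grid.
Context {R : realType}.
Implicit Types v : int -> int -> R.

Definition grid_periodic (M : nat) v : Prop :=
  forall i j : int, v (i + M%:Z) j = v i j /\ v i (j + M%:Z) = v i j.

Definition grid_norm (M : nat) v : R :=
  \big[Num.max/0]_(1 <= i < M.+1) \big[Num.max/0]_(1 <= j < M.+1)
    `|v i%:Z j%:Z|.

Definition grid_laplacian (h : R) v (i j : int) : R :=
  h ^- 2 * (v (i + 1) j + v (i - 1) j + v i (j + 1) + v i (j - 1)
            - 4 * v i j).

Definition restrict_to_grid (h : R) (u : R -> R -> R) (i j : int) : R :=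
  u (i%:~R * h) (j%:~R * h).

End Grid.

Section Alikhanov.
Context {R : realType}.

Definition Gamma (x : R) : R :=
  \int[lebesgue_measure]_(s in `]0, +oo[) (s `^ (x - 1) * expR (- s)).

Definition omega (mu s : R) : R := s `^ (mu - 1) / Gamma mu.

Variables (alpha theta : R) (t : nat -> R).

(* tau_k is meant for 1 <= k and r_k for 2 <= k. *)
Definition step (k : nat) : R := t k - t k.-1.
Definition step_ratio (k : nat) : R := step k / step k.-1.
Definition max_step (N : nat) : R := \big[Num.max/0]_(1 <= k < N.+1) step k.

Definition toff (n : nat) : R := (1 - theta) * t n + theta * t n.-1.
Definition tmid (k : nat) : R := (t k + t k.-1) / 2.

(* As in the notation a^(n)_{n-k}, the last argument of coef_a, coef_b and
   coef_A is j = n - k. *)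
Definition coef_a (n j : nat) : R :=
  let k := (n - j)%N in
  (step k)^-1 *
  \int[lebesgue_measure]_(s in `[t k.-1, Num.min (t k) (toff n)])
    omega (1 - alpha) (toff n - s).

Definition coef_b (n j : nat) : R :=
  let k := (n - j)%N in
  2 / (step k * (step k + step k.+1)) *
  \int[lebesgue_measure]_(s in `[t k.-1, t k])
    ((s - tmid k) * omega (1 - alpha) (toff n - s)).

Definition coef_A (n j : nat) : R :=
  let k := (n - j)%N in
  if n == 1%N then coef_a 1%N 0%N
  else if k == n then coef_a n 0%N + coef_b n 1%N / step_ratio n
  else if k == 1%N then coef_a n j - coef_b n j
  else coef_a n j + coef_b n j.+1 / step_ratio k - coef_b n j.

Definition alikhanov (w : nat -> R) (n : nat) : R :=
  \sum_(1 <= k < n.+1) coef_A n (n - k) * (w k - w k.-1).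

Implicit Type phi : nat -> int -> int -> R.

Definition phi_bar phi (n : nat) (i j : int) : R :=
  (1 - theta) * phi n i j + theta * phi n.-1 i j.

Definition phi_hat phi (n : nat) (i j : int) : R :=
  if n == 1%N then phi 0%N i j
  else Num.min
    (Num.max ((1 + (1 - theta) * step_ratio n) * phi n.-1 i j
              - (1 - theta) * step_ratio n * phi n.-2 i j) (-1)) 1.

Definition imex_alikhanov (eps h kappa : R) (f : R -> R) (M N : nat)
    (phi_init : R -> R -> R) phi : Prop :=
  phi 0%N = restrict_to_grid h phi_init /\
  forall n : nat, (1 <= n <= N)%N ->
    grid_periodic M (phi n) /\
    forall i j : int,
      alikhanov (fun m => phi m i j) n =
      eps ^+ 2 * grid_laplacian h (phi_bar phi n) i j
      + f (phi_hat phi n i j)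
      - kappa * (phi_bar phi n i j - phi_hat phi n i j).

End Alikhanov.

(* Main.v *)
Require Import Defs.
From HB Require Import structures.
From mathcomp Require Import all_boot all_order all_algebra.
From mathcomp Require Import all_classical all_reals all_analysis measurable_realfun.
From mathcomp Require Import ring lra zify.

Set Implicit Arguments.
Unset Strict Implicit.
Unset Printing Implicit Defensive.

Import Order.TTheory GRing.Theory Num.Theory.
Import numFieldNormedType.Exports.
Local Open Scope classical_set_scope.
Local Open Scope ring_scope.

(* Proof. Write T = t_(n-theta), g(s) = omega_(1-alpha)(T - s), an increasing
   convex function of s < T, and A_k for A^(n)_(n-k). Comparing the integrals over
   single steps with the value and the slope of g at the nodes gives, for
   1 <= k < n,
     g(t_(k-1)) <= A_k <= g(t_k),
   where only the upper bound uses the ratio condition; and since theta =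
   alpha / 2, the singular integral in A_n yields
     A_n >= (1 - theta) / (1 - alpha) g(t_(n-1)).
   Hence the A_k are nonnegative and nondecreasing in k, and
     A_n - A_(n-1) >= theta / (1 - alpha) g(t_(n-1)),
   which dominates theta (4 eps^2 / h^2 + kappa) under the restriction on tau,
   because (1 - alpha) Gamma(1 - alpha) <= Gamma(2 - alpha).
   The bound on phi^n then follows by induction on n: by summation by parts the
   scheme, read at a maximum point of phi^n (or of - phi^n), expresses A_n phi^n
   plus a nonnegative diffusion and reaction part as a combination with
   nonnegative weights of older values, plus f + kappa at the extrapolated value.
   The latter is at most kappa: x |-> f(x) + kappa x is nondecreasing on [-1, 1],
   and f(-1) = f(1) = 0 since -1 and 1 are local minima of F. *)

(** * Integrals and first moments over one interval, by comparison with quadratics *)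

Section IntervalAverages.
Context {R : realType}.
Local Notation mu := (@lebesgue_measure R).
Implicit Types (g : R -> R) (p q G : R).

Lemma continuous_itv_integrable g p q : {within `[p, q], continuous g} ->
  mu.-integrable `[p, q] (EFin \o g).
Proof.
by move=> cg; apply: continuous_compact_integrable => //; exact: segment_compact.
Qed.

Lemma Rintegral_continuous_FTC2 (f F : R -> R) p q : p < q ->
  {within `[p, q], continuous f} ->
  (forall x : R, p < x < q -> is_derive x 1 F (f x)) ->
  {within `[p, q], continuous F} ->
  \int[mu]_(x in `[p, q]) f x = F q - F p.
Proof.
move=> pq cf dF /(continuous_within_itvP _ pq)[_ Fp Fq].
rewrite /Rintegral (@continuous_FTC2 _ _ F) //.
- split=> // x; rewrite in_itv /= => xpq.
  exact: (@ex_derive _ _ _ _ _ _ _ (dF x xpq)).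
- move=> x; rewrite in_itv /= => xpq; rewrite derive1E.
  exact: (@derive_val _ _ _ _ _ _ _ (dF x xpq)).
Qed.

Lemma continuous_quadratic (a b c m : R) :
  continuous (fun s : R => a + b * (s - m) + c * (s - m) ^+ 2).
Proof.
move=> x; apply: differentiable_continuous; apply/derivable1_diffP.
exact: ex_derive.
Qed.

(** Centering at the midpoint makes the linear term odd, so it integrates to zero: in the
    comparisons below the slope [b] can be chosen freely. *)
Lemma Rintegral_centered_quadratic p q a b c : p < q ->
  \int[mu]_(s in `[p, q])
    (a + b * (s - (p + q) / 2) + c * (s - (p + q) / 2) ^+ 2) =
  a * (q - p) + c * (q - p) ^+ 3 / 12.
Proof.
move=> pq; set m := (p + q) / 2.
pose F (s : R) : R := a * s + b / 2 * (s - m) ^+ 2 + c / 3 * (s - m) ^+ 3.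
have dF (x : R) : is_derive x 1 F (a + b * (x - m) + c * (x - m) ^+ 2).
  by apply: is_derive_eq; rewrite /GRing.scale /=; field.
rewrite (@Rintegral_continuous_FTC2 _ F) //.
- by rewrite /F /m; field.
- exact/continuous_subspaceT/continuous_quadratic.
- apply: continuous_subspaceT => x.
  by apply: differentiable_continuous; apply/derivable1_diffP.
Qed.

Section QuadraticBounds.
Variables (h : R -> R) (p q : R).
Hypotheses (pq : p < q) (ch : {within `[p, q], continuous h}).
Let m := (p + q) / 2.

Let quadratic_integrable a b c :
  mu.-integrable `[p, q]
    (EFin \o (fun s : R => a + b * (s - m) + c * (s - m) ^+ 2)).
Proof.
apply: continuous_itv_integrable.
exact/continuous_subspaceT/continuous_quadratic.
Qed.

Lemma Rintegral_ge_quadratic a b c :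
  (forall s : R, p <= s <= q -> a + b * (s - m) + c * (s - m) ^+ 2 <= h s) ->
  a * (q - p) + c * (q - p) ^+ 3 / 12 <= \int[mu]_(s in `[p, q]) h s.
Proof.
move=> le_h; rewrite -(Rintegral_centered_quadratic a b c pq) -/m.
by apply: le_Rintegral => //; exact: continuous_itv_integrable.
Qed.

Lemma Rintegral_le_quadratic a b c :
  (forall s : R, p <= s <= q -> h s <= a + b * (s - m) + c * (s - m) ^+ 2) ->
  \int[mu]_(s in `[p, q]) h s <= a * (q - p) + c * (q - p) ^+ 3 / 12.
Proof.
move=> le_h; rewrite -(Rintegral_centered_quadratic a b c pq) -/m.
by apply: le_Rintegral => //; exact: continuous_itv_integrable.
Qed.

End QuadraticBounds.

Section FirstMoment.
Variables (g : R -> R) (p q : R).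
Hypotheses (pq : p < q) (cg : {within `[p, q], continuous g}).
Local Notation m := ((p + q) / 2).

Lemma continuous_affineM a b :
  {within `[p, q], continuous (fun s => (a + b * (s - m)) * g s)}.
Proof.
move=> x; apply: (@cvgM _ _ _ _ (fun s : subspace `[p, q] => a + b * (s - m)) g).
- have := @continuous_subspaceT _ _ `[p, q] _ (@continuous_quadratic a b 0 m).
  have -> : (fun s : R => a + b * (s - m) + 0 * (s - m) ^+ 2) =
      (fun s => a + b * (s - m)) by apply/funext => s; rewrite mul0r addr0.
  exact.
- exact: cg.
Qed.

Let continuous_first_moment :
  {within `[p, q], continuous (fun s => (s - m) * g s)}.
Proof.
have -> : (fun s => (s - m) * g s) = (fun s => (0 + 1 * (s - m)) * g s).
  by apply/funext => s; rewrite add0r mul1r.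
exact: continuous_affineM.
Qed.

Hypothesis g_ndecr : forall x y : R, p <= x -> x <= y -> y <= q -> g x <= g y.

(** By monotonicity [(s - m) * (g s - g m) >= 0], and [(s - m) * g m] has integral zero. *)
Lemma first_moment_ge0 : 0 <= \int[mu]_(s in `[p, q]) ((s - m) * g s).
Proof.
have := @Rintegral_ge_quadratic _ _ _ pq continuous_first_moment 0 (g m) 0.
rewrite !mul0r addr0; apply=> s /andP[ps sq]; rewrite add0r mul0r addr0 mulrC.
have [ms|/ltW sm] := leP m s.
  by rewrite ler_wpM2l ?subr_ge0// g_ndecr//; lra.
by rewrite ler_wnM2l ?subr_le0// g_ndecr//; lra.
Qed.

(** Since [(q - p) / 2 - (s - m) = q - s], the claim is the integrated form of
    [(q - s) * g p <= (q - s) * g s]. *)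
Lemma first_moment_le_mean :
  \int[mu]_(s in `[p, q]) ((s - m) * g s) <=
  (q - p) / 2 * (\int[mu]_(s in `[p, q]) g s - g p * (q - p)).
Proof.
have := @Rintegral_ge_quadratic _ _ _ pq (@continuous_affineM ((q - p) / 2) (-1))
  ((q - p) / 2 * g p) (- g p) 0.
have -> : \int[mu]_(s in `[p, q]) (((q - p) / 2 + -1 * (s - m)) * g s) =
   (q - p) / 2 * \int[mu]_(s in `[p, q]) g s
     - \int[mu]_(s in `[p, q]) ((s - m) * g s).
  have ig : mu.-integrable `[p, q] (EFin \o g) by exact: continuous_itv_integrable.
  rewrite -RintegralZl // -RintegralB //.
  - by apply: eq_Rintegral => s _; rewrite mulN1r mulrBl.
  - exact: eq_integrable (integrableZl _ ((q - p) / 2) ig).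
  - exact: continuous_itv_integrable.
have le_g (s : R) : p <= s <= q ->
    (q - p) / 2 * g p + - g p * (s - m) + 0 * (s - m) ^+ 2 <=
    ((q - p) / 2 + -1 * (s - m)) * g s.
  move=> /andP[ps sq].
  have : (q - s) * g p <= (q - s) * g s.
    by rewrite ler_wpM2l ?subr_ge0// g_ndecr.
  set u := g p; set v := g s; lra.
by move=> /(_ le_g); lra.
Qed.

End FirstMoment.

Section Slope.
Variables (g : R -> R) (p q G : R).
Hypotheses (pq : p < q) (cg : {within `[p, q], continuous g}).
Local Notation m := ((p + q) / 2).

(** The slope bound gives [(s - m) * (g s - g m) <= G * (s - m) ^+ 2] on both sides of [m]; the
    right-hand side integrates to [G * (q - p) ^+ 3 / 12]. *)
Lemma first_moment_le_slope :
  (forall x y : R, p <= x -> x <= y -> y <= q -> g y - g x <= G * (y - x)) ->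
  \int[mu]_(s in `[p, q]) ((s - m) * g s) <= G * (q - p) ^+ 3 / 12.
Proof.
move=> gG.
have ch : {within `[p, q], continuous (fun s => (s - m) * g s)}.
  have -> : (fun s => (s - m) * g s) = (fun s => (0 + 1 * (s - m)) * g s).
    by apply/funext => s; rewrite add0r mul1r.
  exact: continuous_affineM.
have := @Rintegral_le_quadratic _ _ _ pq ch 0 (g m) G.
rewrite mul0r add0r; apply=> s /andP[ps sq]; rewrite add0r.
have [ms|/ltW sm] := leP m s.
  have := @gG m s; rewrite ms sq => /(_ _ isT isT) gms.
  have : (s - m) * (g s - g m) <= (s - m) * (G * (s - m)).
    by rewrite ler_wpM2l ?subr_ge0// gms//; lra.
  set u := g m; set v := g s; lra.
have := @gG s m; rewrite ps sm => /(_ isT isT) gms.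
have : (m - s) * (g m - g s) <= (m - s) * (G * (m - s)).
  by rewrite ler_wpM2l ?subr_ge0// gms//; lra.
set u := g m; set v := g s; lra.
Qed.

Lemma Rintegral_le_slope :
  (forall s : R, p <= s <= q -> G * (q - s) <= g q - g s) ->
  \int[mu]_(s in `[p, q]) g s <= (q - p) * (g q - G * (q - p) / 2).
Proof.
move=> gG.
(* The line of slope [G] through [(q, g q)], which lies above [g]; its value at the midpoint is
   [g q - G * (q - p) / 2]. *)
have := @Rintegral_le_quadratic _ _ _ pq cg (g q - G * (q - p) / 2) G 0.
rewrite !mul0r addr0 (mulrC (q - p)); apply=> s psq.
have := gG s psq; lra.
Qed.

End Slope.

End IntervalAverages.

(** * The fundamental theorem for a nonnegative integrand singular at the right end *)

Section ImproperIntegral.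
Context {R : realType}.
Local Notation mu := (@lebesgue_measure R).

(** The usual theorem applies on each [[p, u n]] with [u n] increasing to [q]. Nonnegativity of [f]
    gives monotone convergence of the integrals, and left continuity of [F] at [q] identifies the
    limit. *)
Lemma Rintegral_ge0_FTC2_at_left (f F : R -> R) (p q : R) : p < q ->
  (forall x : R, p <= x < q -> 0 <= f x) ->
  {within `[p, q[, continuous f} ->
  (forall x : R, p < x < q -> is_derive x 1 F (f x)) ->
  F x @[x --> p^'+] --> F p -> F x @[x --> q^'-] --> F q ->
  \int[mu]_(x in `[p, q]) f x = F q - F p.
Proof.
move=> pq f0 cf dF Fp Fq.
(* The shifted index makes the factor [1 / (n + 2)], so that [p < u n] already for [n = 0]. *)
pose u n : R := q - (q - p) * harmonic n.+1.
have uq n : u n < q.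
  by rewrite /u ltrBlDr ltrDl mulr_gt0 ?subr_gt0// /harmonic /= invr_gt0 ltr0n.
have pu n : p < u n.
  rewrite /u ltrBrDr -ltrBrDl gtr_pMr ?subr_gt0//.
  by rewrite /harmonic /= invf_lt1 ?ltr0n// ltr1n.
have u_cvg : u @ \oo --> q.
  rewrite -[X in _ --> X]subr0 -[X in _ - X](mulr0 (q - p)).
  apply: cvgB; first exact: cvg_cst.
  by apply: cvgMr; rewrite (cvg_shiftS (harmonic : nat -> R)); exact: cvg_harmonic.
have u_ndecr : nondecreasing_seq u.
  move=> i j ij; rewrite /u lerD2l lerN2 ler_wpM2l ?subr_ge0 ?(ltW pq)//.
  by rewrite /harmonic /= lef_pV2 ?posrE ?ltr0n// ler_nat.
have itvE : `[p, q[%classic = \bigcup_i `[p, u i]%classic.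
  apply/seteqP; split=> [x /=|x [n _] /=].
    rewrite in_itv /= => /andP[px xq].
    have : \forall n \near \oo, x <= u n by apply: (cvgr_ge q).
    by case=> n _ /(_ n (leqnn n)) xun; exists n => //=; rewrite in_itv /= px.
  by rewrite !in_itv /= => /andP[-> /le_lt_trans ->].
have mf : measurable_fun `[p, q[ f.
  exact: subspace_continuous_measurable_fun.
have sub_itv n : `[p, u n] `<=` `[p, q[.
  by move=> x /=; rewrite !in_itv /= => /andP[-> /le_lt_trans ->].
have cfn n : {within `[p, u n], continuous f}.
  exact: continuous_subspaceW (sub_itv n) cf.
have cF n : {within `[p, u n], continuous F}.
  have dFx (x : R) : p < x < q -> {for x, continuous F}.
    move=> xpq; apply: differentiable_continuous; apply/derivable1_diffP.
    exact: (@ex_derive _ _ _ _ _ _ _ (dF x xpq)).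
  apply/continuous_within_itvP => //; split=> //.
    move=> x; rewrite in_itv /= => /andP[px xu]; apply: dFx.
    by rewrite px (lt_trans xu).
  by apply: cvg_at_left_filter; apply: dFx; rewrite pu uq.
(* The endpoint [q], where [f] need not be continuous, has measure zero and is removed. *)
rewrite /Rintegral -integral_itv_bndo_bndc; last exact/measurable_EFinP.
rewrite itvE.
have cvI : (\int[mu]_(x in `[p, u i]%classic) (f x)%:E @[i --> \oo] -->
    \int[mu]_(x in \bigcup_i `[p, u i]%classic) (f x)%:E)%E.
  apply: ge0_nondecreasing_set_cvg_integral => //.
  - move=> i j ij; apply/subsetPset => x /=.
    by rewrite !in_itv /= => /andP[-> xu]; rewrite (le_trans xu)// u_ndecr.
  - by move=> i; apply/measurable_EFinP; apply: measurable_funS mf.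
  - by move=> i x /sub_itv; rewrite lee_fin /= in_itv; exact: f0.
have cvF : (\int[mu]_(x in `[p, u i]%classic) (f x)%:E @[i --> \oo] --> (F q - F p)%:E)%E.
  have E i : (\int[mu]_(x in `[p, u i]%classic) (f x)%:E)%E = (F (u i) - F p)%:E.
    have dFi (x : R) : p < x < u i -> is_derive x 1 F (f x).
      by move=> /andP[px xu]; apply: dF; rewrite px (lt_trans xu).
    rewrite -(Rintegral_continuous_FTC2 (pu i) (cfn i) dFi (cF i)).
    rewrite /Rintegral fineK//; apply: integrable_fin_num => //.
    exact: continuous_itv_integrable.
  under eq_cvg do rewrite E.
  apply: cvg_EFin; first exact: nearW.
  apply: cvgB; last exact: cvg_cst.
  by move/cvg_at_leftP : Fq; apply.
by rewrite (cvg_unique _ cvI cvF).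
Qed.

End ImproperIntegral.

(** * The Gamma function: finiteness, positivity and one half of its functional equation *)

Section GammaFunction.
Context {R : realType}.
Local Notation mu := (@lebesgue_measure R).

Lemma integral_expR_tail (a K : R) : 0 < a ->
  (\int[mu]_(s in `[K, +oo[) (expR (- a * s))%:E = (expR (- a * K) / a)%:E)%E.
Proof.
move=> a0.
have dF (x : R) : is_derive x 1 (fun s : R => - expR (- a * s) / a) (expR (- a * x)).
  by apply: is_derive_eq; rewrite /GRing.scale /=; field; rewrite gt_eqF.
have cF : continuous (fun s : R => - expR (- a * s) / a).
  by move=> x; apply: differentiable_continuous; apply/derivable1_diffP.
rewrite (@ge0_continuous_FTC2y _ _ (fun s => - expR (- a * s) / a) _ 0)//.
- by rewrite -EFinB; congr _%:E; rewrite sub0r mulNr opprK.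
- apply: continuous_subspaceT => x.
  by apply: differentiable_continuous; apply/derivable1_diffP.
- rewrite [X in _ --> X](_ : 0 = - 0 / a); last by rewrite oppr0 mul0r.
  apply: cvgMl; apply: cvgN.
  rewrite (_ : (fun x => expR (- a * x)) =
               (fun z => expR (- z)) \o (fun z => a * z)); last first.
    by apply/funext => x /=; rewrite mulNr.
  apply: (@cvg_comp _ _ _ _ _ _ (pinfty_nbhs R)); last exact: cvgr_expR.
  exact: gt0_cvgMry.
- exact/cvg_at_right_filter/cF.
- by move=> x _; rewrite derive1E derive_val.
Qed.

Definition Gamma_density (c s : R) : R := s `^ (c - 1) * expR (- s).

Lemma Gamma_density_ge0 c s : 0 <= Gamma_density c s.
Proof. by rewrite mulr_ge0// ?powR_ge0 ?expR_ge0. Qed.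

Lemma measurable_Gamma_density c (D : set R) :
  measurable_fun D (EFin \o Gamma_density c).
Proof.
apply/measurable_EFinP/measurable_funTS; apply: measurable_funM.
  exact: measurable_powR.
by apply: measurableT_comp; [exact: measurable_expR|exact: measurable_funN].
Qed.

Lemma continuous_Gamma_density c (p q : R) : 0 < p ->
  {within `[p, q], continuous (Gamma_density c)}.
Proof.
move=> p0; apply: derivable_within_continuous => x.
rewrite in_itv /= => /andP[px _].
have x0 : 0 < x by exact: lt_le_trans px.
have dx := is_derive1_powR (c - 1) x0.
exact: ex_derive.
Qed.

(** Integrates the derivative of [s ^ c * exp (- s)]; staying away from 0 keeps all integrands
    continuous. *)
Lemma Gamma_density_parts (c p q : R) : 0 < p -> p < q ->
  c * \int[mu]_(s in `[p, q]) Gamma_density c s =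
  \int[mu]_(s in `[p, q]) Gamma_density (c + 1) s
  + (q `^ c * expR (- q) - p `^ c * expR (- p)).
Proof.
move=> p0 pq.
have cG d : {within `[p, q], continuous (Gamma_density d)}.
  exact: continuous_Gamma_density.
have iG d : mu.-integrable `[p, q] (EFin \o Gamma_density d).
  exact: continuous_itv_integrable.
have dF (x : R) : 0 < x -> is_derive x 1 (fun s : R => s `^ c * expR (- s))
    (c * Gamma_density c x - Gamma_density (c + 1) x).
  move=> x0; have dx := is_derive1_powR c x0.
  apply: is_derive_eq; rewrite /GRing.scale /= /Gamma_density addrK; ring.
have cf : {within `[p, q], continuous
    (fun s => c * Gamma_density c s - Gamma_density (c + 1) s)}.
  apply: derivable_within_continuous => x; rewrite in_itv /= => /andP[px _].
  have x0 : 0 < x by exact: lt_le_trans px.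
  have dx := is_derive1_powR (c - 1) x0.
  have dx1 := is_derive1_powR (c + 1 - 1) x0.
  exact: ex_derive.
have cF : {within `[p, q], continuous (fun s : R => s `^ c * expR (- s))}.
  apply: derivable_within_continuous => x; rewrite in_itv /= => /andP[px _].
  by have := dF x (lt_le_trans p0 px).
rewrite -(Rintegral_continuous_FTC2 pq cf _ cF); last first.
  by move=> x /andP[px _]; apply: dF; exact: lt_trans px.
have iZ : mu.-integrable `[p, q] (EFin \o (fun s => c * Gamma_density c s)).
  exact: eq_integrable (integrableZl _ c (iG c)).
rewrite RintegralB// RintegralZl//; lra.
Qed.

(** Kept extended-real because finiteness at [c] is deduced only afterwards, from the inequality
    between the values at [c] and [c + 1]. *)
Let Gint (c : R) : \bar R := (\int[mu]_(s in `]0%R, +oo[) (Gamma_density c s)%:E)%E.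

(* The boundary term [q ^ c * exp (- q)] of the integration by parts is absorbed
   by the tail of the integral on the right, so no limit is needed here. *)
Let le_Gint_itv (c p q : R) : 0 < c -> 0 < p -> p < q ->
  (c%:E * \int[mu]_(s in `[p, q]) (Gamma_density c s)%:E <= Gint (c + 1))%E.
Proof.
move=> c0 p0 pq.
have iG d : mu.-integrable `[p, q] (EFin \o Gamma_density d).
  by apply: continuous_itv_integrable; exact: continuous_Gamma_density.
have GE d : (\int[mu]_(s in `[p, q]) (Gamma_density d s)%:E =
    (\int[mu]_(s in `[p, q]) Gamma_density d s)%:E)%E.
  by rewrite /Rintegral fineK//; apply: integrable_fin_num => //; exact: iG.
have mexp (D : set R) : measurable_fun D (fun s : R => (expR (-1 * s))%:E).
  apply/measurable_EFinP; apply: measurableT_comp; first exact: measurable_expR.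
  exact: measurable_funM.
have tail : ((q `^ c * expR (- q))%:E <=
    \int[mu]_(s in `]q, +oo[) (Gamma_density (c + 1) s)%:E)%E.
  rewrite integral_itv_obnd_cbnd; last exact: measurable_Gamma_density.
  have -> : (q `^ c * expR (- q))%:E =
     (\int[mu]_(s in `[q, +oo[) ((q `^ c)%:E * (expR (-1 * s))%:E))%E.
    rewrite ge0_integralZl//.
    - by rewrite integral_expR_tail// mulN1r divr1.
    - exact: mexp.
    - by rewrite lee_fin powR_ge0.
  apply: ge0_le_integral => //.
  - by move=> x _; rewrite mule_ge0// lee_fin ?powR_ge0 ?expR_ge0.
  - by apply: emeasurable_funM => //; exact: mexp.
  - exact: measurable_Gamma_density.
  - move=> x /=; rewrite in_itv /= andbT => qx.
    rewrite -EFinM lee_fin /Gamma_density addrK mulN1r ler_wpM2r ?expR_ge0//.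
    by rewrite ge0_ler_powR ?nnegrE ?(ltW c0)//; lra.
rewrite GE -EFinM Gamma_density_parts//.
apply: (@le_trans _ _ (\int[mu]_(s in `[p, q]) (Gamma_density (c + 1) s)%:E +
    \int[mu]_(s in `]q, +oo[) (Gamma_density (c + 1) s)%:E)%E).
  rewrite GE EFinD; apply: leeD2l; apply: le_trans tail.
  by rewrite lee_fin lerBlDr lerDl mulr_ge0// ?powR_ge0 ?expR_ge0.
rewrite -ge0_integral_setU//.
- apply: ge0_subset_integral => //.
  + exact: measurableU.
  + exact: measurable_Gamma_density.
  + by move=> x _; rewrite lee_fin Gamma_density_ge0.
  + by move=> x /= []; rewrite !in_itv /= => /andP[]; lra.
- exact: measurable_Gamma_density.
- by move=> x _; rewrite lee_fin Gamma_density_ge0.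
- apply/disj_setPRL => x /=; rewrite in_itv /= andbT => qx.
  by rewrite in_itv /= => /andP[_]; rewrite leNgt qx.
Qed.

(** Monotone convergence along intervals [[1 / (n + 2), n + 2]], which are nondegenerate from
    [n = 0] on and exhaust the half-line. *)
Let le_Gint (c : R) : 0 < c -> (c%:E * Gint c <= Gint (c + 1))%E.
Proof.
move=> c0.
pose E n : set R := `[n.+2%:R^-1, n.+2%:R]%classic.
have E_ndecr : nondecreasing_seq E.
  move=> i j ij; apply/subsetPset => x; rewrite /E /= !in_itv /= => /andP[ix xi].
  apply/andP; split; last by rewrite (le_trans xi)// ler_nat.
  by apply: le_trans ix; rewrite lef_pV2 ?posrE ?ltr0n// ler_nat.
have itvE : `]0%R, +oo[%classic = \bigcup_n E n.
  apply/seteqP; split=> [x|x [n _]]; rewrite /E /= !in_itv /= !andbT.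
    move=> x0; pose y := Num.max x x^-1.
    exists (Num.truncn y) => //=.
    have yt : y <= (Num.truncn y).+2%:R.
      by apply: ltW; apply: lt_trans (truncnS_gt y) _; rewrite ltr_nat.
    rewrite /E /= in_itv /=; apply/andP; split.
      rewrite -[leRHS]invrK lef_pV2 ?posrE ?invr_gt0 ?ltr0n//.
      by apply: le_trans yt; rewrite le_max lexx orbT.
    by apply: le_trans yt; rewrite le_max lexx.
  by move=> /andP[nx _]; apply: lt_le_trans nx; rewrite invr_gt0 ltr0n.
have cvI : (\int[mu]_(s in E i) (Gamma_density c s)%:E @[i --> \oo] --> Gint c)%E.
  rewrite /Gint itvE; apply: ge0_nondecreasing_set_cvg_integral => //.
  - by move=> i; exact: measurable_itv.
  - by move=> i; exact: measurable_Gamma_density.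
  - by move=> i x _; rewrite lee_fin Gamma_density_ge0.
have {}cvI := cvgeZl (isT : c%:E \is a fin_num) cvI.
apply: (cvge_le _ cvI); apply: nearW => n; apply: le_Gint_itv => //.
by apply: (@lt_trans _ _ 1); rewrite ?invf_lt1 ?ltr0n ?ltr1n.
Qed.

(** For [0 < c <= 1], [s ^ c <= 1 + s <= 2 * exp (s / 2)], so the integrand is dominated by
    [2 * exp (- s / 2)]. *)
Let Gint_fin (c : R) : 0 < c <= 1 -> (Gint (c + 1) < +oo)%E.
Proof.
move=> /andP[c0 c1].
have mexp (D : set R) : measurable_fun D (fun s : R => (expR (- 2^-1 * s))%:E).
  apply/measurable_EFinP; apply: measurableT_comp; first exact: measurable_expR.
  exact: measurable_funM.
apply: (@le_lt_trans _ _
    (\int[mu]_(s in `]0%R, +oo[) (2%:E * (expR (- 2^-1 * s))%:E))%E).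
  apply: ge0_le_integral => //.
  - by move=> x _; rewrite lee_fin Gamma_density_ge0.
  - exact: measurable_Gamma_density.
  - by apply: emeasurable_funM => //; exact: mexp.
  - move=> x /=; rewrite in_itv /= andbT => x0.
    rewrite -EFinM lee_fin /Gamma_density addrK.
    have -> : - x = - 2^-1 * x + - 2^-1 * x by lra.
    rewrite expRD mulrA ler_wpM2r ?expR_ge0//.
    rewrite mulNr expRN ler_pdivrMr ?expR_gt0//.
    have e2 : 1 + 2^-1 * x <= expR (2^-1 * x) by exact: expR_ge1Dx.
    suff : x `^ c <= 1 + x by lra.
    have [x1|/ltW x1] := leP x 1.
      apply: (@le_trans _ _ (x `^ 0)); last by rewrite powRr0; lra.
      by rewrite ger_powR ?x0// ltW.
    by apply: le_trans (ler1_powR x1 c1) _; lra.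
rewrite ge0_integralZl//; last exact: mexp.
rewrite integral_itv_obnd_cbnd; last exact: mexp.
by rewrite integral_expR_tail// -EFinM ltry.
Qed.

(** The singularity at 0 is not estimated directly: an infinite value at [c] would force one at
    [c + 1] through [le_Gint]. *)
Let Gint_fin_num (c : R) : 0 < c <= 1 -> Gint c \is a fin_num.
Proof.
move=> c01; rewrite ge0_fin_numE; last first.
  by apply: integral_ge0 => x _; rewrite lee_fin Gamma_density_ge0.
have /andP[c0 _] := c01.
have := le_lt_trans (le_Gint c0) (Gint_fin c01).
by case: (Gint c) => [r| |]; rewrite ?ltry// gt0_muley ?lte_fin.
Qed.

(** On []0, 1]] the density is at least [exp (- 1)]. Finiteness matters too, since the real-valued
    integral sends an infinite value to 0. *)
Lemma Gamma_gt0 (c : R) : 0 < c <= 1 -> 0 < Gamma c.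
Proof.
move=> c01; have /andP[c0 c1] := c01.
have e0 : 0 < expR (-1 : R) by exact: expR_gt0.
suff : ((expR (-1))%:E <= Gint c)%E.
  rewrite -[Gint c]fineK ?Gint_fin_num// lee_fin; exact: lt_le_trans.
have <- : (\int[mu]_(s in `]0%R, 1%R]) (expR (-1))%:E = (expR (-1))%:E)%E.
  rewrite integral_cst//= lebesgue_measure_itv /= lte_fin ltr01 oppr0 adde0.
  by rewrite mule1.
apply: (@le_trans _ _ (\int[mu]_(s in `]0%R, 1%R]) (Gamma_density c s)%:E)%E).
  apply: ge0_le_integral => //.
  - exact: measurable_Gamma_density.
  - move=> x /=; rewrite in_itv /= lee_fin => /andP[x0 x1].
    rewrite -[leLHS]mul1r ler_pM ?expR_ge0// ?ler_expR ?lerN2//.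
    by rewrite -[leLHS](powRr0 x) ger_powR ?x0//; lra.
apply: ge0_subset_integral => //.
- exact: measurable_Gamma_density.
- by move=> x _; rewrite lee_fin Gamma_density_ge0.
- by move=> x /=; rewrite !in_itv /= andbT => /andP[].
Qed.

Lemma le_Gamma_succ (c : R) : 0 < c <= 1 -> c * Gamma c <= Gamma (c + 1).
Proof.
move=> c01; have /andP[c0 _] := c01; have := le_Gint c0.
rewrite -[Gint c]fineK ?Gint_fin_num// -[Gint (c + 1)]fineK; last first.
  rewrite ge0_fin_numE ?Gint_fin//.
  by apply: integral_ge0 => x _; rewrite lee_fin Gamma_density_ge0.
by rewrite -EFinM lee_fin.
Qed.

End GammaFunction.

(** * The kernel [g] as an increasing convex function of [s < T] *)

Section Kernel.
Context {R : realType}.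
Local Notation mu := (@lebesgue_measure R).
Variables (alpha T : R).
Hypothesis alpha01 : 0 < alpha < 1.
Local Notation g s := (omega (1 - alpha) (T - s)).

(** The derivative of the kernel in [s]; its monotonicity expresses the convexity of the kernel. *)
Definition kernel_slope (s : R) : R :=
  alpha / Gamma (1 - alpha) * (T - s) `^ (- alpha - 1).

Lemma Gamma_1Balpha_gt0 : 0 < Gamma (1 - alpha).
Proof. by apply: Gamma_gt0; move: alpha01 => /andP[a0 a1]; lra. Qed.

Lemma kernelE (s : R) : g s = (T - s) `^ (- alpha) / Gamma (1 - alpha).
Proof. by rewrite /omega addrAC subrr add0r. Qed.

Lemma kernel_ge0 (s : R) : 0 <= g s.
Proof. by rewrite divr_ge0 ?powR_ge0// ltW ?Gamma_1Balpha_gt0. Qed.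

Lemma is_derive_powR_reflected (a s : R) : s < T ->
  is_derive s 1 (fun s => (T - s) `^ a) (- (a * (T - s) `^ (a - 1))).
Proof.
move=> sT; have Ts0 : 0 < T - s by rewrite subr_gt0.
have dp := is_derive1_powR a Ts0.
have dT : is_derive s 1 (fun s : R => T - s) (-1).
  by apply: is_derive_eq; rewrite add0r mul1r.
have := @is_derive1_comp _ (fun x => x `^ a) (fun s : R => T - s) s _ _ dp dT.
by move=> d; apply: is_derive_eq; rewrite mulrN1.
Qed.

Lemma is_derive_kernel (s : R) : s < T ->
  is_derive s 1 (fun s => g s) (kernel_slope s).
Proof.
move=> sT; have d := is_derive_powR_reflected (- alpha) sT.
have -> : (fun s => g s) = (fun s => (T - s) `^ (- alpha) * (Gamma (1 - alpha))^-1).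
  by apply/funext => x; exact: kernelE.
apply: is_derive_eq; rewrite /GRing.scale /= /kernel_slope; ring.
Qed.

Lemma continuous_kernel (p q : R) : q < T -> {within `[p, q], continuous (fun s => g s)}.
Proof.
move=> qT; apply: derivable_within_continuous => x; rewrite in_itv /= => /andP[_ xq].
have d := is_derive_kernel (le_lt_trans xq qT); exact: ex_derive.
Qed.

Lemma kernel_slope_ge0 (s : R) : 0 <= kernel_slope s.
Proof.
have := Gamma_1Balpha_gt0; move: alpha01 => /andP[a0 _] G0.
by rewrite mulr_ge0 ?powR_ge0// divr_ge0// ltW.
Qed.

Lemma kernel_slope_ndecr (x y : R) : x <= y -> y < T ->
  kernel_slope x <= kernel_slope y.
Proof.
move=> xy yT; have := Gamma_1Balpha_gt0; move: alpha01 => /andP[a0 _] G0.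
rewrite /kernel_slope ler_wpM2l ?divr_ge0 ?(ltW a0) ?(ltW G0)//.
rewrite -opprD !powRN lef_pV2 ?posrE ?powR_gt0 ?subr_gt0//; last exact: le_lt_trans yT.
by rewrite ge0_ler_powR ?nnegrE//; lra.
Qed.

Lemma kernel_slopeP (x y : R) : x <= y -> y < T ->
  kernel_slope x * (y - x) <= g y - g x <= kernel_slope y * (y - x).
Proof.
move=> xy yT.
have [|c] := @MVT_segment _ (fun s => g s) kernel_slope _ _ xy _ (continuous_kernel yT).
  move=> z; rewrite in_itv /= => /andP[_ zy]; apply: is_derive_kernel.
  exact: lt_trans yT.
rewrite in_itv /= => /andP[xc cy] ->.
by rewrite !ler_wpM2r ?subr_ge0 ?kernel_slope_ndecr// (le_lt_trans cy).
Qed.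

Lemma kernel_ndecr (x y : R) : x <= y -> y < T -> g x <= g y.
Proof.
move=> xy yT; have /andP[+ _] := kernel_slopeP xy yT.
have : 0 <= kernel_slope x * (y - x) by rewrite mulr_ge0 ?kernel_slope_ge0 ?subr_ge0.
lra.
Qed.

(** The antiderivative is a negative multiple of [(T - s) ^ (1 - alpha)], which tends to 0 at [T]
    because [alpha < 1]; splitting off one factor [T - p] brings back [g p]. *)
Lemma Rintegral_kernel_singular (p : R) : p < T ->
  \int[mu]_(s in `[p, T]) g s = (T - p) * g p / (1 - alpha).
Proof.
move=> pT; have /andP[a0 a1] := alpha01.
have G0 := Gamma_1Balpha_gt0.
have a'0 : 0 < 1 - alpha by lra.
pose F (s : R) : R := (- (Gamma (1 - alpha) * (1 - alpha))^-1) * (T - s) `^ (1 - alpha).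
have dF (x : R) : x < T -> is_derive x 1 F (g x).
  move=> xT; have d := is_derive_powR_reflected (1 - alpha) xT.
  apply: is_derive_eq; rewrite /GRing.scale /= /omega; field.
  by rewrite !gt_eqF.
have cg : {within `[p, T[, continuous (fun s => g s)}.
  apply: derivable_within_continuous => x; rewrite in_itv /= => /andP[_ xT].
  by have d := is_derive_kernel xT; exact: ex_derive.
have dF' (x : R) : p < x < T -> is_derive x 1 F (g x).
  by move=> /andP[_ xT]; exact: dF.
have Fp : F x @[x --> p^'+] --> F p.
  apply: cvg_at_right_filter; apply: differentiable_continuous.
  by apply/derivable1_diffP; have d := dF p pT; exact: ex_derive.
have F_T : F T = 0 by rewrite /F subrr powR0 ?gt_eqF// mulr0.
have FT : F x @[x --> T^'-] --> F T.
  rewrite F_T -(mulr0 (- (Gamma (1 - alpha) * (1 - alpha))^-1)).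
  apply/cvg_at_leftP => u [uT u_cvg]; apply: cvgMr.
  have /cvg_at_rightP := powR_cvg0 a'0.
  apply; split=> [n|]; first by rewrite subr_gt0.
  by rewrite -(subrr T); apply: cvgB => //; exact: cvg_cst.
rewrite (Rintegral_ge0_FTC2_at_left pT _ cg dF' Fp FT); last first.
  by move=> x _; exact: kernel_ge0.
rewrite F_T /F /omega -(@mulr_powRB1 _ (T - p) (1 - alpha)) ?subr_ge0 ?ltW//.
by field; rewrite !gt_eqF.
Qed.

End Kernel.

(** * Two-sided bounds on the coefficients of the Alikhanov formula *)

Section Coefficients.
Context {R : realType}.
Local Notation mu := (@lebesgue_measure R).
Variables (alpha theta : R) (t : nat -> R) (n : nat).
Hypotheses (alpha01 : 0 < alpha < 1) (theta_def : theta = alpha / 2).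
Hypothesis n_gt0 : (0 < n)%N.
Hypothesis t_incr : forall k, (1 <= k <= n)%N -> t k.-1 < t k.
Hypothesis ratio_ge : forall k, (2 <= k <= n)%N -> 4 / 7 <= step_ratio t k.

Local Notation T := (toff theta t n).
Local Notation g s := (omega (1 - alpha) (T - s)).
Local Notation A k := (coef_A alpha theta t n (n - k)).
Local Notation a k := (coef_a alpha theta t n (n - k)).
Local Notation b k := (coef_b alpha theta t n (n - k)).
Local Notation moment k :=
  (\int[mu]_(s in `[t k.-1, t k]) ((s - (t k.-1 + t k) / 2) * g s)).

Let theta_bnd : 0 < theta < 2^-1.
Proof. by move: alpha01 => /andP[a0 a1]; rewrite theta_def; apply/andP; split; lra. Qed.

Let toffB : T - t n.-1 = (1 - theta) * step t n.
Proof. by rewrite /toff /step; ring. Qed.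

Lemma step_gt0 k : (1 <= k <= n)%N -> 0 < step t k.
Proof. by move=> kn; rewrite /step subr_gt0 t_incr. Qed.

(** Confines the singularity of the kernel to the last step, and makes the minimum in [coef_a] equal
    to [t k] on every earlier one. *)
Lemma t_lt_toff k : (k < n)%N -> t k < T.
Proof.
move=> kn; have t_mono m : (k <= m)%N -> (m <= n)%N -> t k <= t m.
  elim: m => [|m IH]; first by rewrite leqn0 => /eqP ->.
  rewrite leq_eqVlt => /orP[/eqP -> //|km mn].
  by apply: le_trans (IH km (ltnW mn)) (ltW (@t_incr m.+1 _)).
apply: (@le_lt_trans _ _ (t n.-1)).
  by apply: t_mono; [rewrite -ltnS prednK|exact: leq_pred].
rewrite -subr_gt0 toffB mulr_gt0 ?step_gt0 ?n_gt0 ?leqnn//.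
by move: theta_bnd => /andP[]; lra.
Qed.

Let coef_aE k : (1 <= k < n)%N ->
  a k = (step t k)^-1 * \int[mu]_(s in `[t k.-1, t k]) g s.
Proof.
by move=> /andP[k0 kn]; rewrite /coef_a subKn ?(ltnW kn)// min_l// ltW// t_lt_toff.
Qed.

Let coef_bE k : (1 <= k < n)%N ->
  b k = 2 / (step t k * (step t k + step t k.+1)) * moment k.
Proof.
move=> /andP[k0 kn]; rewrite /coef_b subKn ?(ltnW kn)// /tmid.
by rewrite (addrC (t k)).
Qed.

Section OneStep.
Variable k : nat.
Hypothesis k_bnd : (1 <= k < n)%N.

Let tk : t k.-1 < t k.
Proof. by apply: t_incr; case/andP: k_bnd => -> /ltnW. Qed.

Let step_k : 0 < step t k.
Proof. by rewrite subr_gt0. Qed.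

Let step_kS : 0 < step t k.+1.
Proof. by apply: step_gt0; case/andP: k_bnd. Qed.

Let tkT : t k < T.
Proof. by apply: t_lt_toff; case/andP: k_bnd. Qed.

Let cg : {within `[t k.-1, t k], continuous (fun s => g s)}.
Proof. exact: continuous_kernel. Qed.

Let g_ndecr (x y : R) : t k.-1 <= x -> x <= y -> y <= t k -> g x <= g y.
Proof. by move=> _ xy yt; apply: kernel_ndecr => //; exact: le_lt_trans tkT. Qed.

Lemma coef_b_ge0 : 0 <= b k.
Proof.
rewrite coef_bE// mulr_ge0//; last exact: first_moment_ge0.
by rewrite divr_ge0// ltW// mulr_gt0// addr_gt0.
Qed.

(** As the moment is nonnegative, dropping the next step from the denominator only enlarges [b k];
    [first_moment_le_mean] then bounds it by [a k - g (t k.-1)]. *)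
Lemma kernel_le_coef_aBb : g (t k.-1) <= a k - b k.
Proof.
have := first_moment_le_mean tk cg g_ndecr.
have := first_moment_ge0 tk cg g_ndecr.
rewrite coef_aE// coef_bE// -/(step t k).
set m := moment k; set I := \int[mu]_(s in _) _; set u := g _.
move: step_k step_kS; set x := step t k; set y := step t k.+1 => x0 y0 m0 mI.
have xm : m / (x * (x + y)) <= m / (x * x).
  have xx : 0 < x * x by exact: mulr_gt0.
  have xy : x * x <= x * (x + y) by nra.
  by rewrite ler_wpM2l// lef_pV2 ?posrE//; exact: lt_le_trans xy.
have mx : m / (x * x) <= (I / x - u) / 2.
  have -> : (I / x - u) / 2 = (x / 2 * (I - u * x)) / (x * x) by field; lra.
  by rewrite ler_wpM2r// invr_ge0 mulr_ge0// ltW.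
have -> : 2 / (x * (x + y)) * m = 2 * (m / (x * (x + y))) by ring.
rewrite (mulrC x^-1); lra.
Qed.

(* The slope at the common node [t k.-1] appears both here, over step [k], and in
   [coef_b_le_slope], over step [k - 1]: it makes the two terms comparable. *)
Lemma coef_a_le_kernel :
  a k <= g (t k) - kernel_slope alpha T (t k.-1) * step t k / 2.
Proof.
rewrite coef_aE// ler_pdivrMl//; apply: Rintegral_le_slope => // s /andP[ts st].
have /andP[+ _] := kernel_slopeP alpha01 st tkT.
apply: le_trans; rewrite ler_wpM2r ?subr_ge0//.
by apply: kernel_slope_ndecr => //; exact: le_lt_trans tkT.
Qed.

Lemma coef_b_le_slope :
  b k <= kernel_slope alpha T (t k) * step t k ^+ 2 / (6 * (step t k + step t k.+1)).
Proof.
have G0 := kernel_slope_ge0 T alpha01 (t k).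
have le_m : moment k <= kernel_slope alpha T (t k) * step t k ^+ 3 / 12.
  apply: first_moment_le_slope => // x y tx xy yt.
  have yT := le_lt_trans yt tkT.
  have /andP[_] := kernel_slopeP alpha01 xy yT.
  move=> /le_trans; apply; rewrite ler_wpM2r ?subr_ge0//.
  exact: kernel_slope_ndecr.
rewrite coef_bE//; move: step_k step_kS le_m.
set x := step t k; set y := step t k.+1 => x0 y0 le_m.
have -> : kernel_slope alpha T (t k) * x ^+ 2 / (6 * (x + y)) =
  2 / (x * (x + y)) * (kernel_slope alpha T (t k) * x ^+ 3 / 12) by field; lra.
by rewrite ler_wpM2l// divr_ge0// mulr_ge0; lra.
Qed.

End OneStep.

Let ratio_gt0 k : (2 <= k <= n)%N -> 0 < step_ratio t k.
Proof. by move=> kn; have := ratio_ge kn; lra. Qed.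

Lemma coef_A_ge_kernel k : (1 <= k < n)%N -> g (t k.-1) <= A k.
Proof.
move=> k_bnd; have /andP[k0 kn] := k_bnd.
have n1 : (n == 1)%N = false by case: n kn k0 => [|[|m]] //; case: (k).
rewrite /coef_A n1 subKn ?(ltnW kn)// ltn_eqF//.
have aBb := kernel_le_coef_aBb k_bnd.
case: eqVneq => [//|k1].
have k2 : (1 < k)%N by rewrite ltn_neqAle eq_sym k1.
(* Indices count backwards from [n], so the successor of [n - k] designates the preceding step
   [k - 1]. *)
have -> : (n - k).+1 = (n - k.-1)%N by rewrite -subSn ?(ltnW kn)// -{1}(prednK k0) subSS.
have b0 : 0 <= b k.-1.
  apply: coef_b_ge0; rewrite (leq_ltn_trans (leq_pred k) kn) andbT.
  by rewrite -ltnS (prednK k0).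
have : 0 <= b k.-1 / step_ratio t k.
  by rewrite divr_ge0// ltW// ratio_gt0// k2 ltnW.
lra.
Qed.

(** The only term that could exceed the bound is [b k.-1 / step_ratio t k]; it is absorbed by the
    convexity gain [kernel_slope * step / 2] of [coef_a_le_kernel]. *)
Lemma coef_A_le_kernel k : (1 <= k < n)%N -> A k <= g (t k).
Proof.
move=> k_bnd; have /andP[k0 kn] := k_bnd.
have n1 : (n == 1)%N = false by case: n kn k0 => [|[|m]] //; case: (k).
rewrite /coef_A n1 subKn ?(ltnW kn)// ltn_eqF//.
have a_le := coef_a_le_kernel k_bnd.
have b0 := coef_b_ge0 k_bnd.
have G0 := kernel_slope_ge0 T alpha01 (t k.-1).
have sk : 0 < step t k by apply: step_gt0; rewrite k0 ltnW.
case: eqVneq => [_|k1].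
  have : 0 <= kernel_slope alpha T (t k.-1) * step t k by rewrite mulr_ge0// ltW.
  lra.
have k2 : (1 < k)%N by rewrite ltn_neqAle eq_sym k1.
have -> : (n - k).+1 = (n - k.-1)%N by rewrite -subSn ?(ltnW kn)// -{1}(prednK k0) subSS.
have k'_bnd : (1 <= k.-1 < n)%N.
  by rewrite (leq_ltn_trans (leq_pred k) kn) andbT -ltnS (prednK k0).
have b_le := coef_b_le_slope k'_bnd; rewrite prednK// in b_le.
have sk' : 0 < step t k.-1.
  by apply: step_gt0; case/andP: k'_bnd => -> /ltnW.
have r_ge : 4 / 7 <= step_ratio t k by apply: ratio_ge; rewrite k2 ltnW.
rewrite /step_ratio ler_pdivlMr// in r_ge.
suff : b k.-1 / step_ratio t k <= kernel_slope alpha T (t k.-1) * step t k / 2 by lra.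
move: sk sk' r_ge b_le G0; rewrite /step_ratio.
set x := step t k.-1; set y := step t k; set G := kernel_slope _ _ _.
move=> y0 x0 r_ge b_le G0.
rewrite invf_div; apply: (@le_trans _ _ (G * x ^+ 2 / (6 * (x + y)) * (x / y))).
  by rewrite ler_wpM2r// divr_ge0// ltW.
have -> : G * x ^+ 2 / (6 * (x + y)) * (x / y) = G * (x ^+ 3 / (6 * (x + y) * y)).
  by field; lra.
rewrite -[leRHS]mulrA ler_wpM2l// ler_pdivrMr//; last by rewrite !mulr_gt0// addr_gt0.
(* The ratio condition enters only through [x ^ 3 <= 3 y ^ 2 (x + y)]. *)
have xx : 16 / 49 * (x * x) <= y * y by nra.
(* Three times the left-hand side is [528 / 343 * x ^ 3], which exceeds [x ^ 3]. *)
have : 16 / 49 * (x * x) * (x + 4 / 7 * x) <= y * y * (x + y).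
  by apply: ler_pM => //; nra.
have : 0 <= x * x * x by rewrite !mulr_ge0// ltW.
rewrite !exprS expr0; lra.
Qed.

(** On the last step the integral stops at [T], and its length [T - t n.-1 = (1 - theta) * step t n]
    cancels the factor [1 / step t n]; the remaining term, present for [n >= 2], is nonnegative. *)
Lemma coef_A_last_ge :
  (1 - theta) / (1 - alpha) * g (t n.-1) <= A n.
Proof.
have tT : t n.-1 < T by apply: t_lt_toff; rewrite prednK.
have sn : 0 < step t n by apply: step_gt0; rewrite n_gt0 leqnn.
have aE : coef_a alpha theta t n 0 = (1 - theta) / (1 - alpha) * g (t n.-1).
  rewrite /coef_a subn0 min_r; last first.
    rewrite /toff -subr_ge0.
    have -> : t n - ((1 - theta) * t n + theta * t n.-1) = theta * step t n.
      by rewrite /step; ring.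
    by rewrite mulr_ge0// ltW//; case/andP: theta_bnd.
  rewrite Rintegral_kernel_singular// toffB; field.
  by rewrite gt_eqF//=; move: alpha01 => /andP[]; lra.
rewrite subnn /coef_A subn0 eqxx.
case: eqVneq => [n1|n1]; first by rewrite -aE n1.
rewrite -aE lerDl divr_ge0//.
  have n2 : (1 < n)%N by rewrite ltn_neqAle eq_sym n1.
  have -> : 1%N = (n - n.-1)%N by rewrite -{1}(prednK n_gt0) subSnn.
  by apply: coef_b_ge0; rewrite prednK// leqnn andbT -ltnS prednK.
by rewrite ltW// ratio_gt0// leqnn andbT ltn_neqAle eq_sym n1.
Qed.

End Coefficients.

(** * Zeros of the reaction term and monotonicity of its stabilized form *)

Section Nonlinearity.
Context {R : realType}.
Implicit Types F f : R -> R.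

(** Near a strict minimum the difference quotient has the sign of the increment [k], so a positive
    limit is refuted by a small [k < 0] and a negative one by a small [k > 0]. *)
Lemma derive1_strict_local_min F (x : R) :
  derivable F x 1 -> strict_local_min F x -> derive1 F x = 0.
Proof.
move=> dF [e1 /= e1_gt0 Fmin]; rewrite derive1E.
have {}Fmin (k : R) : k != 0 -> `|k| < e1 -> 0 < F (k + x) - F x.
  move=> k0 ke; rewrite subr_gt0; apply: Fmin => /=.
    by rewrite opprD addrCA subrr addr0 normrN.
  by rewrite -subr_eq0 addrK.
pose q (k : R) := k^-1 * (F (k + x) - F x).
have q_cvg : q k @[k --> 0^'] --> 'D_1 F x.
  rewrite (_ : q = fun k => k^-1 *: ((F \o shift x) (k *: 1) - F x)); first exact: dF.
  by apply/funext => k /=; rewrite [_%:A]mulr1.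
apply/eqP; rewrite eq_le !leNgt; apply/andP; split; apply/negP => d0.
  have [e2 /= e2_gt0 q_gt0] := cvgr_gt _ q_cvg _ d0.
  have m0 : 0 < Num.min e1 e2 by rewrite lt_min e1_gt0.
  pose k : R := - (Num.min e1 e2 / 2).
  have k0 : k < 0 by rewrite oppr_lt0 divr_gt0.
  have ke (e : R) : Num.min e1 e2 <= e -> `|k| < e.
    by rewrite ltr0_norm// /k; lra.
  have : 0 < q k.
    apply: q_gt0; last by rewrite lt_eqF.
    by rewrite /= sub0r normrN ke// ge_min lexx orbT.
  apply/negP; rewrite -leNgt /q nmulr_rle0 ?invr_lt0// ltW// Fmin ?lt_eqF//.
  by rewrite ke// ge_min lexx.
have [e2 /= e2_gt0 q_lt0] := cvgr_lt _ q_cvg _ d0.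
have m0 : 0 < Num.min e1 e2 by rewrite lt_min e1_gt0.
pose k : R := Num.min e1 e2 / 2.
have k0 : 0 < k by rewrite divr_gt0.
have ke (e : R) : Num.min e1 e2 <= e -> `|k| < e by rewrite gtr0_norm// /k; lra.
have : q k < 0.
  apply: q_lt0; last by rewrite gt_eqF.
  by rewrite /= sub0r normrN ke// ge_min lexx orbT.
apply/negP; rewrite -leNgt /q pmulr_rge0 ?invr_gt0// ltW// Fmin ?gt_eqF//.
by rewrite ke// ge_min lexx.
Qed.

(** The extreme value theorem bounds the set of values, so that [sup] is a genuine upper bound. *)
Lemma abs_derive1_le_C_norm f (x : R) :
  C1_on_m11 f -> x \in `[-1, 1] -> `|derive1 f x| <= C_norm_m11 (derive1 f).
Proof.
move=> [_ cf'] x11; rewrite /C_norm_m11.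
have cN : {within `[-1, 1], continuous (fun y => `|derive1 f y|)}.
  by move=> y; apply: cvg_norm; exact: cf'.
have m11 : (-1 : R) <= 1 by lra.
have [c _ cmax] := EVT_max m11 cN.
apply: ub_le_sup; last by exists x.
by exists `|derive1 f c| => _ [y y11 <-]; exact: cmax.
Qed.

Lemma stabilized_reaction_bound f (kappa : R) : C1_on_m11 f ->
  C_norm_m11 (derive1 f) <= kappa -> f (-1) = 0 -> f 1 = 0 ->
  0 <= kappa /\ (forall x : R, -1 <= x <= 1 -> `|f x + kappa * x| <= kappa).
Proof.
move=> C1f kappa_ge fN1 f1.
have f'_le (x : R) : x \in `[-1, 1] -> `|derive1 f x| <= kappa.
  by move=> x11; apply: le_trans (abs_derive1_le_C_norm C1f x11) kappa_ge.
have [df _] := C1f.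
have N1in : (-1 : R) \in `[-1, 1] by rewrite in_itv /=; apply/andP; split; lra.
have p1in : (1 : R) \in `[-1, 1] by rewrite in_itv /=; apply/andP; split; lra.
split; first exact: le_trans (f'_le _ p1in).
pose g (x : R) := f x + kappa * x.
have dg (x : R) : x \in `[-1, 1] -> is_derive x 1 g (derive1 f x + kappa).
  move=> x11; have d : is_derive x 1 f (derive1 f x).
    by rewrite derive1E; exact/derivableP/df.
  by apply: is_derive_eq; rewrite /GRing.scale /= mulr1.
have g_ndecr : {in `[-1, 1] &, {homo g : x y / x <= y}}.
  apply: ger0_derive1_le_cc.
  - by move=> x /subset_itv_oo_cc x11; have := dg x x11.
  - move=> x /subset_itv_oo_cc x11; have d := dg x x11.
    by rewrite derive1E derive_val; have := f'_le x x11; rewrite ler_norml; lra.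
  - by apply: derivable_within_continuous => x x11; have := dg x x11.
move=> x /andP[xN1 x1].
have x11 : x \in `[-1, 1] by rewrite in_itv /= xN1.
have := g_ndecr _ _ N1in x11 xN1; have := g_ndecr _ _ x11 p1in x1.
rewrite /g fN1 f1 ler_norml; lra.
Qed.

End Nonlinearity.

(** * Reduction of periodic grid functions to one period *)

Section PeriodicGrid.
Context {R : realType}.
Variables (M : nat) (v : int -> int -> R).
Hypotheses (M_gt0 : (0 < M)%N) (v_periodic : grid_periodic M v).

Lemma periodic_addM (w : int -> R) : (forall i : int, w (i + M%:Z) = w i) ->
  forall i k : int, w (i + k * M%:Z) = w i.
Proof.
move=> w_per i k; have nat_case (m : nat) (j : int) : w (j + m%:Z * M%:Z) = w j.
  elim: m j => [|m IH] j; first by rewrite mul0r addr0.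
  by rewrite intS mulrDl mul1r addrA IH w_per.
case: k => m; first exact: nat_case.
by rewrite -(nat_case m.+1) NegzE -addrA -mulrDl addNr mul0r addr0.
Qed.

(** The representative depends on [i] alone, so it serves for either coordinate while the other is
    held fixed. *)
Lemma grid_repr (i : int) : exists2 p : nat, (1 <= p <= M)%N &
  forall w : int -> R, (forall i : int, w (i + M%:Z) = w i) -> w i = w p%:Z.
Proof.
have M0 : M%:Z != 0 by rewrite gt_eqF.
(* Reducing [i - 1] and adding 1 back places the representative in [1..M], the range of
   [grid_norm]. *)
pose r := `|((i - 1) %% M%:Z)%Z|%N.
have rE : ((i - 1) %% M%:Z)%Z = r%:Z by rewrite /r gez0_abs// modz_ge0.
exists r.+1.
  have := @ltz_pmod (i - 1) M%:Z; rewrite rE; lia.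
move=> w w_per.
have -> : i = r.+1%:Z + ((i - 1) %/ M%:Z)%Z * M%:Z.
  have := divz_eq (i - 1) M%:Z; rewrite rE; lia.
exact: periodic_addM.
Qed.

Lemma grid_norm_le1P :
  (grid_norm M v <= 1) <-> (forall i j : int, `|v i j| <= 1).
Proof.
split=> [le1 i j|le1]; last first.
  by rewrite /grid_norm; apply: bigmax_le => // p _; exact: bigmax_le.
have [p pM vp] := grid_repr i.
have -> : v i j = v p%:Z j by apply: (vp (v ^~ j)) => k; case: (v_periodic k j).
have [q qM vq] := grid_repr j.
have -> : v p%:Z j = v p%:Z q%:Z by apply: vq => k; case: (v_periodic p%:Z k).
apply: le_trans le1; rewrite /grid_norm.
apply: (bigmax_sup_seq _ p) => //; first by rewrite mem_index_iota ltnS.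
by apply: (le_bigmax_seq _ q) => //; rewrite mem_index_iota ltnS.
Qed.

Lemma grid_has_max : exists i0 j0 : int, forall i j : int, v i j <= v i0 j0.
Proof.
pose o := Ordinal M_gt0.
pose G (p : 'I_M * 'I_M) := v (val p.1).+1%:Z (val p.2).+1%:Z.
have [[p0 q0] _ pq_max] := @arg_maxP _ _ _ (o, o) xpredT G isT.
exists p0.+1%:Z, q0.+1%:Z => i j.
have [[|p] pM vp] := grid_repr i => //.
have -> : v i j = v p.+1%:Z j by apply: (vp (v ^~ j)) => k; case: (v_periodic k j).
have [[|q] qM vq] := grid_repr j => //.
have -> : v p.+1%:Z j = v p.+1%:Z q.+1%:Z.
  by apply: vq => k; case: (v_periodic p.+1%:Z k).
exact: (pq_max (Ordinal pM, Ordinal qM)).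
Qed.

End PeriodicGrid.

(** * Lower bound for the discrete derivative and use of the step restriction *)

Section Scheme.
Context {R : realType}.

(** Summation by parts in [v = 1 - w]: the difference of the two sides is [B 1 * v 0] plus the sum
    of [(B k.+1 - B k) * v k] for [1 <= k < m], all nonnegative. *)
Lemma abel_sum_ge (B w : nat -> R) (m : nat) : (0 < m)%N -> 0 <= B 1%N ->
  (forall k, (1 <= k < m)%N -> B k <= B k.+1) ->
  (forall k, (k <= m)%N -> w k <= 1) ->
  - (B m * (1 - w m)) <= \sum_(1 <= k < m.+1) B k * (w k - w k.-1).
Proof.
move=> m0 B1; elim: m m0 => // -[_ _ _ w1|m IH _ B_ndecr w1].
  rewrite big_nat1 -subr_ge0.
  have -> : B 1%N * (w 1%N - w 0%N) - - (B 1%N * (1 - w 1%N)) = B 1%N * (1 - w 0%N).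
    by ring.
  by rewrite mulr_ge0// subr_ge0 w1.
rewrite big_nat_recr//=.
have Bm : B m.+1 <= B m.+2 by apply: B_ndecr; rewrite ltnS leqnn.
have wm : w m.+1 <= 1 by exact: w1.
have le_B : B m.+1 * (1 - w m.+1) <= B m.+2 * (1 - w m.+1).
  by rewrite ler_wpM2r// subr_ge0.
have le_S : - (B m.+1 * (1 - w m.+1)) <=
    \sum_(1 <= k < m.+2) B k * (w k - w k.-1).
  apply: IH => // [k /andP[k1 km]|k km].
    by apply: B_ndecr; rewrite k1 ltnS ltnW.
  by apply: w1; exact: ltnW.
lra.
Qed.

Section MainStep.
Variables (alpha theta : R) (t : nat -> R) (n : nat).
Hypotheses (alpha01 : 0 < alpha < 1) (theta_def : theta = alpha / 2).
Hypothesis n_gt0 : (0 < n)%N.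
Hypothesis t_incr : forall k, (1 <= k <= n)%N -> t k.-1 < t k.
Hypothesis ratio_ge : forall k, (2 <= k <= n)%N -> 4 / 7 <= step_ratio t k.
Local Notation g s := (omega (1 - alpha) (toff theta t n - s)).

(** All the history is compressed into level [n - 1]. Writing [g (t n.-1)] for the coefficient of
    step [n - 1], which it dominates, also covers [n = 1], where there is no such step. *)
Lemma alikhanov_ge (w : nat -> R) : (forall k, (k < n)%N -> w k <= 1) ->
  coef_A alpha theta t n 0 * (w n - w n.-1) - g (t n.-1) * (1 - w n.-1) <=
  alikhanov alpha theta t w n.
Proof.
move=> w1; rewrite /alikhanov big_nat_recr//= subnn [leRHS]addrC lerD2l.
have w'1 : w n.-1 <= 1 by apply: w1; rewrite prednK.
have [n1|n1] := eqVneq n 1%N.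
  rewrite big_geq ?n1//= oppr_le0 mulr_ge0 ?kernel_ge0//.
  by move: w'1; rewrite n1 /= subr_ge0.
have n2 : (1 < n)%N by rewrite ltn_neqAle eq_sym n1.
have n'0 : (0 < n.-1)%N by rewrite -ltnS prednK.
have n'n : (n.-1 < n)%N by rewrite prednK.
pose B k := coef_A alpha theta t n (n - k).
have B_n' : B n.-1 <= g (t n.-1) by apply: coef_A_le_kernel; rewrite ?n'0.
have -> : \sum_(1 <= k < n) coef_A alpha theta t n (n - k) * (w k - w k.-1) =
    \sum_(1 <= k < n.-1.+1) B k * (w k - w k.-1) by rewrite prednK.
apply: le_trans (abel_sum_ge n'0 _ _ _).
- by rewrite lerN2 ler_wpM2r// subr_ge0.
- apply: le_trans (kernel_ge0 _ alpha01 (t 0%N)) _.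
  by apply: (@coef_A_ge_kernel _ alpha theta t n _ _ _ _ _ 1%N).
(* Consecutive coefficients are compared through the kernel value at their common node [t k]. *)
- move=> k /andP[k0 kn']; have kn : (k.+1 < n)%N by rewrite -(prednK n_gt0) ltnS.
  apply: le_trans (_ : _ <= g (t k)) _.
    by apply: coef_A_le_kernel; rewrite ?k0 ?(ltnW kn).
  by apply: (@coef_A_ge_kernel _ alpha theta t n _ _ _ _ _ k.+1).
- by move=> k kn'; apply: w1; rewrite -(prednK n_gt0) ltnS.
Qed.

End MainStep.

(** Here [s] stands for [((1 - theta) * tau) ^ alpha], [ta] for [tau ^ alpha], and [G1], [G] for
    Gamma at [1 - alpha] and [2 - alpha]. The constant suffices because [th < 1 / 2] gives
    [4 <= 11 * (1 - th)]. *)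
Lemma le_inv_mul_bound (a th K s ta G1 G : R) :
  0 < a < 1 -> 0 < th < 2^-1 -> 0 < K -> 0 < s -> s <= ta -> 0 < G1 ->
  (1 - a) * G1 <= G -> ta <= 4 / (11 * (1 - th) * K * G) ->
  K <= s^-1 / G1 / (1 - a).
Proof.
move=> /andP[a0 a1] /andP[th0 th1] K0 s0 s_le G10 le_G ta_le.
have a'0 : 0 < 1 - a by lra.
have aG0 : 0 < (1 - a) * G1 by exact: mulr_gt0.
have G0 : 0 < G by exact: lt_le_trans le_G.
have th'0 : 0 < 1 - th by lra.
have -> : s^-1 / G1 / (1 - a) = 1 / ((1 - a) * G1 * s).
  by field; rewrite !gt_eqF.
rewrite ler_pdivlMr; last by rewrite !mulr_gt0.
set D := _ / _ in ta_le.
have le_GD : (1 - a) * G1 * s <= G * D.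
  by apply: ler_pM => //; [exact: ltW|exact: ltW|exact: le_trans ta_le].
apply: le_trans (ler_wpM2l (ltW K0) le_GD) _.
have -> : K * (G * D) = 4 / (11 * (1 - th)).
  by rewrite /D; field; rewrite !gt_eqF.
by rewrite ler_pdivrMr; lra.
Qed.

Lemma le_kernel_of_step_le (alpha theta tau K : R) :
  0 < alpha < 1 -> 0 < theta < 2^-1 -> 0 < tau -> 0 < K ->
  tau <= (4 / (11 * (1 - theta) * K * Gamma (2 - alpha))) `^ alpha^-1 ->
  K <= omega (1 - alpha) ((1 - theta) * tau) / (1 - alpha).
Proof.
move=> a01 th01 tau0 K0 tau_le.
have th'01 : 0 < 1 - theta /\ 1 - theta <= 1.
  by case/andP: th01 => ? ?; split; lra.
have a'01 : 0 < 1 - alpha <= 1 by case/andP: a01 => ? ?; apply/andP; split; lra.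
have aE : 1 - alpha - 1 = - alpha by ring.
have aE2 : 2 - alpha = (1 - alpha) + 1 by ring.
have [a0 _] := andP a01; have [th0 th1] := th'01.
have s0 : 0 < ((1 - theta) * tau) `^ alpha by rewrite powR_gt0// mulr_gt0.
have s_le : ((1 - theta) * tau) `^ alpha <= tau `^ alpha.
  rewrite ge0_ler_powR ?nnegrE ?(ltW a0) ?(ltW tau0) ?(ltW (mulr_gt0 _ _))//.
  by rewrite ler_piMl// ltW.
rewrite /omega aE powRN.
apply: (le_inv_mul_bound a01 th01 K0 s0 s_le (Gamma_gt0 a'01)
  (le_Gamma_succ a'01)).
rewrite -aE2; set D := 4 / _ in tau_le *.
have D0 : 0 <= D.
  rewrite /D divr_ge0// !mulr_ge0// ?(ltW th0) ?(ltW K0)// aE2.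
  apply: le_trans (le_Gamma_succ a'01).
  by rewrite mulr_ge0// ltW// ?Gamma_gt0//; case/andP: a'01.
(* The step restriction is raised to the power [alpha]. *)
have -> : D = (D `^ alpha^-1) `^ alpha.
  by rewrite -powRrM mulVf ?gt_eqF// powRr1.
by rewrite ge0_ler_powR ?nnegrE ?powR_ge0// ltW.
Qed.

End Scheme.

(** * One time step, read at a maximum point *)

Section MaximumStep.
Context {R : realType}.

(** [W], [w] are the values at levels [n] and [n - 1], [lW], [lw] their Laplacians, [r] the
    stabilized reaction. Collecting terms, [(A0 + kappa * (1 - th)) * (W - 1)] is at most
    [(th * (K + kappa) - (A0 - A1)) * (1 - w)], which is nonpositive. *)
Lemma maximum_point_le1 (A0 A1 S th kappa K e W w lW lw r : R) :
  0 <= th <= 1 -> 0 <= kappa -> 0 < A0 -> 0 <= e ->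
  th * (K + kappa) <= A0 - A1 ->
  w <= 1 -> lW <= 0 -> e * lw <= K * (1 - w) -> r <= kappa ->
  A0 * (W - w) - A1 * (1 - w) <= S ->
  S = e * ((1 - th) * lW + th * lw) + r - kappa * ((1 - th) * W + th * w) ->
  W <= 1.
Proof.
move=> /andP[th0 th1] k0 A00 e0 A_ge w1 lW0 lw_le r_le S_ge S_eq.
have p1 : e * ((1 - th) * lW) <= 0.
  by rewrite mulr_ge0_le0// mulr_ge0_le0// subr_ge0.
have p2 : th * (e * lw) <= th * (K * (1 - w)) by rewrite ler_wpM2l.
have p3 : th * (K + kappa) * (1 - w) <= (A0 - A1) * (1 - w).
  by rewrite ler_wpM2r// subr_ge0.
have c0 : 0 < A0 + kappa * (1 - th) by rewrite ltr_wpDr// mulr_ge0// subr_ge0.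
rewrite -subr_le0 -(pmulr_rle0 _ c0); lra.
Qed.

(** With [y = g / (1 - a)], [A0 - g >= (1 - th) * y - (1 - a) * y = (a - th) * y], and [a - th = th]
    by the choice [th = a / 2]. *)
Lemma coef_gap (a th g X A0 : R) : 0 < a < 1 -> th = a / 2 -> 0 < X ->
  X <= g / (1 - a) -> (1 - th) / (1 - a) * g <= A0 ->
  0 < A0 /\ th * X <= A0 - g.
Proof.
move=> /andP[a0 a1] th_def X0 X_le A0_ge.
have a'0 : 0 < 1 - a by lra.
have gE : g = (1 - a) * (g / (1 - a)) by field; rewrite gt_eqF.
have {}A0_ge : (1 - th) * (g / (1 - a)) <= A0 by rewrite mulrA mulrAC.
rewrite [X in _ - X]gE; set y := g / (1 - a) in X_le A0_ge *.
have y0 : 0 < y by lra.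
have p : th * X <= th * y by rewrite ler_wpM2l// th_def; lra.
have q : 0 < (1 - th) * y by rewrite mulr_gt0// th_def; lra.
by split; rewrite ?th_def in p q A0_ge *; lra.
Qed.

(** Used with [c] the maximum of the new level, where the bound is 0, and with [c = 1] for the
    previous level, where it produces the constant [4 / h ^ 2]. *)
Lemma grid_laplacian_le (h : R) (v : int -> int -> R) (i j : int) (c : R) :
  (forall i' j' : int, v i' j' <= c) ->
  grid_laplacian h v i j <= h ^- 2 * (4 * (c - v i j)).
Proof.
move=> v_le; rewrite /grid_laplacian ler_wpM2l ?invr_ge0 ?sqr_ge0//.
have := v_le (i + 1) j; have := v_le (i - 1) j.
have := v_le i (j + 1); have := v_le i (j - 1); lra.
Qed.

(** The truncation enforces the bound for [n >= 2]; at [n = 1] the value is that of [phi 0]. *)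
Lemma phi_hat_bound (theta : R) (t : nat -> R) (phi : nat -> int -> int -> R) n i j :
  (forall i j : int, `|phi 0%N i j| <= 1) -> -1 <= phi_hat theta t phi n i j <= 1.
Proof.
move=> phi0; rewrite /phi_hat; case: ifP => _; first by rewrite -ler_norml.
rewrite ge_min lexx orbT le_min le_max lexx orbT andbT /=.
by apply: le_trans (ler01); rewrite lerN10.
Qed.

Section SchemeStep.
Variables (alpha theta eps h kappa : R) (f : R -> R) (t : nat -> R) (n M : nat).
Variable phi : nat -> int -> int -> R.
Hypotheses (alpha01 : 0 < alpha < 1) (theta_def : theta = alpha / 2).
Hypotheses (M_gt0 : (0 < M)%N) (n_gt0 : (0 < n)%N).
Hypothesis t_incr : forall k, (1 <= k <= n)%N -> t k.-1 < t k.
Hypothesis ratio_ge : forall k, (2 <= k <= n)%N -> 4 / 7 <= step_ratio t k.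
Hypothesis kappa_ge0 : 0 <= kappa.
Hypothesis f_bound : forall x : R, -1 <= x <= 1 -> `|f x + kappa * x| <= kappa.
Local Notation K := (4 * eps ^+ 2 / h ^+ 2).
Hypothesis K_gt0 : 0 < K.
Hypothesis K_le :
  K + kappa <= omega (1 - alpha) ((1 - theta) * step t n) / (1 - alpha).
Hypothesis phi_periodic : grid_periodic M (phi n).
Hypothesis phi_eq : forall i j : int,
  alikhanov alpha theta t (fun m => phi m i j) n =
  eps ^+ 2 * grid_laplacian h (phi_bar theta phi n) i j
  + f (phi_hat theta t phi n i j)
  - kappa * (phi_bar theta phi n i j - phi_hat theta t phi n i j).
Hypothesis phi_prev : forall k, (k < n)%N -> forall i j : int, `|phi k i j| <= 1.

(** The sign [e] treats maximum and minimum at once: the scheme is linear apart from the reaction,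
    and [f_bound] controls the absolute value of the latter. *)
Let signed_le1 (e : R) : `|e| = 1 -> forall i j : int, e * phi n i j <= 1.
Proof.
move=> e1; pose u k i j := e * phi k i j.
have u_per : grid_periodic M (u n).
  by move=> i j; rewrite /u; have [-> ->] := phi_periodic i j.
have u_prev k (i j : int) : (k < n)%N -> u k i j <= 1.
  move=> kn; apply: le_trans (ler_norm _) _.
  by rewrite normrM e1 mul1r phi_prev.
have [i0 [j0 u_max]] := grid_has_max M_gt0 u_per.
suff u1 : u n i0 j0 <= 1 by move=> i j; exact: le_trans (u_max i j) u1.
have n'n : (n.-1 < n)%N by rewrite prednK.
have gE : toff theta t n - t n.-1 = (1 - theta) * step t n.
  by rewrite /toff /step; ring.
have [] := @coef_gap alpha theta (omega (1 - alpha) (toff theta t n - t n.-1))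
  (K + kappa) (coef_A alpha theta t n 0) alpha01 theta_def.
- by rewrite ltr_wpDr.
- by rewrite gE.
- have := coef_A_last_ge alpha01 theta_def n_gt0 t_incr ratio_ge.
  by rewrite subnn.
move=> A0_gt0 A_gap.
have u_alikhanov : alikhanov alpha theta t (fun k => u k i0 j0) n =
    e * alikhanov alpha theta t (fun k => phi k i0 j0) n.
  rewrite /alikhanov mulr_sumr; apply: eq_bigr => k _.
  by rewrite /u -mulrBr mulrCA.
apply: (@maximum_point_le1 _ _ (alikhanov alpha theta t (fun k => u k i0 j0) n)
  theta kappa K (eps ^+ 2) (u n i0 j0) (u n.-1 i0 j0)
  (grid_laplacian h (u n) i0 j0) (grid_laplacian h (u n.-1) i0 j0)
  (e * (f (phi_hat theta t phi n i0 j0) + kappa * phi_hat theta t phi n i0 j0))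
  _ kappa_ge0 A0_gt0 (sqr_ge0 _) A_gap).
- by move: alpha01 => /andP[? ?]; rewrite theta_def; apply/andP; split; lra.
- exact: u_prev.
- by have := grid_laplacian_le h i0 j0 u_max; rewrite subrr !mulr0.
- have lap_le := @grid_laplacian_le h (u n.-1) i0 j0 1 (fun i j => u_prev _ i j n'n).
  apply: le_trans (ler_wpM2l (sqr_ge0 eps) lap_le) _.
  by rewrite le_eqVlt; apply/orP; left; apply/eqP; ring.
- apply: le_trans (ler_norm _) _; rewrite normrM e1 mul1r; apply: f_bound.
  by apply: phi_hat_bound => i j; exact: phi_prev.
- have := @alikhanov_ge _ alpha theta t n alpha01 theta_def n_gt0 t_incr ratio_ge
    (fun k => u k i0 j0) (fun k kn => u_prev k i0 j0 kn); exact.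
- by rewrite u_alikhanov phi_eq /grid_laplacian /phi_bar /u; ring.
Qed.

Lemma scheme_step_le1 (i j : int) : `|phi n i j| <= 1.
Proof.
rewrite ler_norml lerNl -[- phi n i j]mulN1r -[X in _ && (X <= _)]mul1r.
by rewrite !signed_le1 ?normrN ?normr1.
Qed.

End SchemeStep.

End MaximumStep.

(** * Assembly by strong induction on the time level *)

Theorem theorem3p1 (R : realType)
    (alpha theta eps L h T rstar kappa : R) (M N : nat) (t : nat -> R)
    (F f : R -> R) (phi_init : R -> R -> R) (phi : nat -> int -> int -> R)
    (halpha : 0 < alpha < 1) (htheta : theta = alpha / 2) (heps : 0 < eps)
    (hL : 0 < L) (hM : (0 < M)%N) (hh : h = L / M%:R)
    (hN : (0 < N)%N) (ht0 : t 0%N = 0) (htN : t N = T)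
    (ht : forall k : nat, (1 <= k <= N)%N -> t k.-1 < t k)
    (hratio : forall k : nat, (2 <= k <= N)%N -> 4 / 7 <= step_ratio t k <= rstar)
    (hF : forall x : R, x \in `[-1, 1] -> derivable F x 1)
    (hbistable : bistable F)
    (hf : forall x : R, f x = - derive1 F x)
    (hC1 : C1_on_m11 f)
    (hkappa : C_norm_m11 (derive1 f) <= kappa)
    (hinit : forall x y : R,
       phi_init (x + L) y = phi_init x y /\ phi_init x (y + L) = phi_init x y)
    (hscheme : imex_alikhanov alpha theta t eps h kappa f M N phi_init phi)
    (hstep : max_step t N <=
       (4 / (11 * (1 - theta) * (4 * eps ^+ 2 / h ^+ 2 + kappa)
             * Gamma (2 - alpha))) `^ (alpha^-1)) :
  grid_norm M (restrict_to_grid h phi_init) <= 1 ->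
  forall n : nat, (1 <= n <= N)%N -> grid_norm M (phi n) <= 1.
Proof.
move=> init_le1.
have /andP[a0 a1] := halpha.
have h0 : 0 < h by rewrite hh divr_gt0// ltr0n.
have Mh : M%:R * h = L by rewrite hh mulrC divfK// gt_eqF// ltr0n.
have [phi0 scheme] := hscheme.
have phi0_per : grid_periodic M (phi 0%N).
  rewrite phi0 => i j; rewrite /restrict_to_grid !intrD !mulrDl.
  have -> : (M%:Z)%:~R * h = L by rewrite -Mh.
  exact: hinit.
have pm1_in (x : R) : x = -1 \/ x = 1 -> x \in `[-1, 1].
  by case=> ->; rewrite in_itv /= lexx ?andbT/= (le_trans _ ler01)// lerN10.
have f_root (x : R) : x = -1 \/ x = 1 -> f x = 0.
  move=> x_pm1; have x11 := pm1_in x x_pm1.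
  rewrite hf (derive1_strict_local_min (hF x x11)) ?oppr0//.
  exact/hbistable.
have [kappa0 f_le] := stabilized_reaction_bound hC1 hkappa
  (f_root _ (or_introl erefl)) (f_root _ (or_intror erefl)).
have K0 : 0 < 4 * eps ^+ 2 / h ^+ 2 by rewrite divr_gt0 ?mulr_gt0 ?exprn_gt0.
have th01 : 0 < theta < 2^-1.
  by rewrite htheta divr_gt0//= ltr_pdivrMr// mulVf.
(* The induction carries the pointwise bound at all integer indices, since the Laplacian reaches
   outside one period. *)
have phi_le1 n : (n <= N)%N -> forall i j : int, `|phi n i j| <= 1.
  elim/ltn_ind: n => n IH nN.
  have [->|n0] := posnP n.
    by apply/(grid_norm_le1P hM phi0_per); rewrite phi0.
  have nN' : (1 <= n <= N)%N by rewrite n0.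
  have [phi_per phi_eq] := scheme n nN'.
  apply: (scheme_step_le1 halpha htheta hM n0 _ _ kappa0 f_le K0 _ phi_per phi_eq).
  - by move=> k /andP[k0 kn]; apply: ht; rewrite k0 (leq_trans kn).
  - move=> k /andP[k2 kn].
    by have := hratio k; rewrite k2 (leq_trans kn nN) => /(_ isT)/andP[].
  - apply: le_kernel_of_step_le => //.
    + by rewrite subr_gt0 ht.
    + by rewrite ltr_wpDr.
    + apply: le_trans hstep; rewrite /max_step.
      by apply: (le_bigmax_seq _ n) => //; rewrite mem_index_iota ltnS.
  - by move=> k kn; apply: IH => //; exact: leq_trans (ltnW kn) nN.
move=> n nN; have [phi_per _] := scheme n nN.
by apply/(grid_norm_le1P hM phi_per) => i j; apply: phi_le1; case/andP: nN.
Qed.
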